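(* Let $n\ge2$ be an integer, $\delta\le0$ a real number, and $a_{n-i,i}$ ($i=0,\dots,n$) real numbers, not all equal to zero. The homogeneous Kukles system $$\dot x=y,\qquad \dot y=\delta x+\sum_{i=0}^n a_{n-i,i}x^{n-i}y^i$$ has a global center if and only if it is of the form $$\dot x=y,\qquad \dot y=\delta x+a_{n,0}x^n+a_{n-2,2}x^{n-2}y^2,$$ where $\delta\le0$, $n$ is odd, $a_{n,0}\le0$, $a_{n-2,2}\le0$ and $\delta^2+a_{n,0}^2\neq0$.
   Context: A center is an equilibrium having a neighbourhood filled with nontrivial periodic orbits (apart from the equilibrium itself). A global center is a center such that the whole phase plane $\mathbb{R}^2$, except for the center equilibrium, is filled with nontrivial periodic orbits. *)

(* Defs.v *)
From Stdlib Require Export Reals.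
From Coquelicot Require Export Coquelicot.
Open Scope R_scope.

Definition solution (X : R * R -> R * R) (g : R -> R * R) : Prop :=
  forall t : R,
    is_derive (fun s => fst (g s)) t (fst (X (g t))) /\
    is_derive (fun s => snd (g s)) t (snd (X (g t))).

(* A periodic orbit is nontrivial when it is not reduced to an equilibrium,
   i.e. when the periodic solution is not constant. *)
Definition on_nontrivial_periodic_orbit (X : R * R -> R * R) (q : R * R) : Prop :=
  exists (g : R -> R * R) (T : R),
    solution X g /\ g 0 = q /\
    0 < T /\ (forall t : R, g (t + T) = g t) /\
    (exists t : R, g t <> g 0).

Definition equilibrium (X : R * R -> R * R) (p : R * R) : Prop :=
  X p = (0, 0).

Definition is_center (X : R * R -> R * R) (p : R * R) : Prop :=
  equilibrium X p /\
  locally p (fun q => q <> p -> on_nontrivial_periodic_orbit X q).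

Definition is_global_center (X : R * R -> R * R) (p : R * R) : Prop :=
  is_center X p /\
  forall q : R * R, q <> p -> on_nontrivial_periodic_orbit X q.

Definition has_global_center (X : R * R -> R * R) : Prop :=
  exists p : R * R, is_global_center X p.

(* The coefficient of x^j y^i is a j i; only the values with j + i = n matter.
   sum_f_R0 f n is the sum of f i over 0 <= i <= n. *)
Definition kukles (n : nat) (delta : R) (a : nat -> nat -> R) (p : R * R) : R * R :=
  let (x, y) := p in
  (y, delta * x + sum_f_R0 (fun i => a (n - i)%nat i * x ^ (n - i) * y ^ i) n).

Definition kukles_even (n : nat) (delta an0 an2 : R) (p : R * R) : R * R :=
  let (x, y) := p in
  (y, delta * x + an0 * x ^ n + an2 * x ^ (n - 2) * y ^ 2).

(* Main.v *)
Require Import Defs.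
From Stdlib Require Import Reals.
From Coquelicot Require Import Coquelicot.
From Stdlib Require Import Psatz Classical.
From Stdlib Require Import IndefiniteDescription FunctionalExtensionality.
Open Scope R_scope.

(** Write Q for the homogeneous part of degree n and q(m) = Q(1,m) for its restriction
    to the line x = 1, so that Q(x,mx) = x^n q(m).

    Necessity. Suppose that q(m) > 0 for some m >= 0. Far out on the right, the slope y/x
    of a solution increases whenever it equals m, because Q dominates there; a solution
    that starts above the ray y = mx thus remains above it, x increases forever, and the
    orbit is not closed ([trapped_above_ray]). Hence q <= 0 on [0, +oo[. The central
    symmetry and the time reversal transport this inequality. For n even the central
    symmetry gives q >= 0 on [0, +oo[ too, hence Q = 0; for n odd the time reversal
    gives q <= 0 on the whole line. If n is odd and q has degree at least 3, then
    Q(x,y) >= kappa y^3 in a strip at the left of the y-axis, for y large, and a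
    solution would become infinite before it crosses the strip ([blow_up_in_strip]). So
    Q = a0 x^n + a1 x^(n-1) y + a2 x^(n-2) y^2, and q <= 0 gives a0 <= 0 and a2 <= 0. The
    equation x'' = g(x) + h(x) x'^2, got by dropping the middle term, has a first integral
    of the form y^2 mu(x) / 2 + V(x); along the full system its derivative is
    a1 x^(n-1) y^2 mu(x), of constant sign since n - 1 is even, and a closed orbit forces
    a1 = 0 ([no_one_signed_damping]). Finally, if delta = a0 = 0, the whole x-axis
    consists of equilibria, none of which lies on a nontrivial orbit, again by the first
    integral.

    Sufficiency. Here x'' = g(x) + h(x) x'^2 with a restoring force g, and x h(x) <= 0. The
    first integral increases strictly from 0 to infinity along every ray from the origin,
    and the vector field turns clockwise around the origin. A level set of the first
    integral is therefore a closed curve, given in log-polar coordinates as a graph over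
    the angle, smooth by the implicit function theorem ([implicit_derive]). The angular
    velocity is positive on it, and the inverse of the time spent as a function of the
    angle gives the periodic solution ([motion_along_closed_curve]). *)

(** * Derivatives, signs and monotonicity *)

Lemma locally_of_derive (f : R -> R) (t l : R) (P : R -> Prop) :
  is_derive f t l -> locally (f t) P -> locally t (fun s => P (f s)).
Proof.
  intros Hf HP.
  apply (ex_derive_continuous f t); [now exists l | exact HP].
Qed.

Lemma derive_pos_locally (f : R -> R) (t l : R) :
  is_derive f t l -> 0 < l ->
  exists eta : posreal, forall s, Rabs (s - t) < eta ->
    (t < s -> f t < f s) /\ (s < t -> f s < f t).
Proof.
  intros Hf Hl. apply is_derive_Reals in Hf.
  destruct (Hf (l / 2)) as [eta Heta]; [lra |].
  exists eta. intros s Hs.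
  assert (Hq : s <> t -> l / 2 < (f s - f t) / (s - t)).
  { intros Hst. specialize (Heta (s - t)).
    replace (t + (s - t)) with s in Heta by ring.
    apply Rabs_def2 in Heta; lra. }
  split; intros Hst.
  - assert (f s - f t = (f s - f t) / (s - t) * (s - t)) by (field; lra).
    assert (l / 2 < (f s - f t) / (s - t)) by (apply Hq; lra). nra.
  - assert (f s - f t = (f s - f t) / (s - t) * (s - t)) by (field; lra).
    assert (l / 2 < (f s - f t) / (s - t)) by (apply Hq; lra). nra.
Qed.

Lemma increasing_of_derive (f f' : R -> R) (u v : R) :
  u < v -> (forall s, u <= s <= v -> is_derive f s (f' s)) ->
  (forall s, u < s < v -> 0 < f' s) -> f u < f v.
Proof.
  intros Huv Hf Hpos.
  destruct (MVT_cor2 f f' u v Huv) as [c [Hc Hcuv]].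
  { intros c Hc. now apply is_derive_Reals, Hf. }
  specialize (Hpos c Hcuv). nra.
Qed.

Lemma nondecreasing_of_derive (f f' : R -> R) (u v : R) :
  u <= v -> (forall s, u <= s <= v -> is_derive f s (f' s)) ->
  (forall s, u < s < v -> 0 <= f' s) -> f u <= f v.
Proof.
  intros [Huv | <-] Hf Hpos; [| lra].
  destruct (MVT_cor2 f f' u v Huv) as [c [Hc Hcuv]].
  { intros c Hc. now apply is_derive_Reals, Hf. }
  specialize (Hpos c Hcuv). nra.
Qed.

Lemma constant_of_derive (f : R -> R) :
  (forall s, is_derive f s 0) -> forall u v, f u = f v.
Proof.
  intros Hf.
  assert (H : forall u v, u < v -> f u = f v).
  { intros u v Huv. apply (eq_is_derive f u v); [| exact Huv]. intros t _. exact (Hf t). }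
  intros u v. destruct (Rtotal_order u v) as [Huv | [<- | Huv]]; auto.
  symmetry; auto.
Qed.

(** Induction along the half-line: it shows that a solution never leaves an open region,
    since only the first exit time has to be excluded. *)
Lemma real_induction (P : R -> Prop) :
  P 0 ->
  (forall t, 0 < t -> (forall s, 0 <= s < t -> P s) -> P t) ->
  (forall t, 0 <= t -> P t -> locally t P) ->
  forall t, 0 <= t -> P t.
Proof.
  intros H0 Hstep Hopen b Hb.
  apply NNPP. intros Hnot.
  set (E := fun t => 0 <= t /\ forall s, 0 <= s <= t -> P s).
  assert (HbE : forall t, E t -> t <= b).
  { intros t [Ht HE]. apply Rnot_lt_le. intros Hlt. apply Hnot, HE. lra. }
  destruct (completeness E) as [m [Hub Hlub]].
  - exists b. exact HbE.
  - exists 0. split; [lra |]. intros s Hs. now replace s with 0 by lra.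
  - assert (Hm0 : 0 <= m).
    { apply Hub. split; [lra |]. intros s Hs. now replace s with 0 by lra. }
    assert (Hbelow : forall s, 0 <= s < m -> P s).
    { intros s Hs. apply NNPP. intros HnP.
      assert (m <= s); [| lra]. apply Hlub. intros t [Ht HE].
      apply Rnot_lt_le. intros Hlt. apply HnP, HE. lra. }
    assert (HPm : P m).
    { destruct Hm0 as [Hm0 | <-]; [now apply Hstep | exact H0]. }
    destruct (Hopen m Hm0 HPm) as [eta Heta].
    assert (m + eta / 2 <= m); [| destruct eta; simpl in *; lra].
    apply Hub. split; [destruct eta; simpl; lra |].
    intros s Hs. destruct (Rlt_le_dec s m) as [Hlt | Hge]; [now apply Hbelow |].
    apply Heta. apply Rabs_def1; unfold minus, plus, opp; simpl;
      destruct eta; simpl in *; lra.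
Qed.

(** This is how the boundary of a region is shown to be uncrossable: at the first time a
    defining function f ceases to be positive, it cannot be increasing. *)
Lemma first_zero_derive_nonpos (f f' : R -> R) (t : R) :
  0 < t -> (forall s, is_derive f s (f' s)) ->
  (forall s, 0 <= s < t -> 0 < f s) -> f t <= 0 -> f t = 0 /\ f' t <= 0.
Proof.
  intros Ht Hf Hpos Hle. split.
  - apply Rle_antisym; [exact Hle |]. apply Rnot_lt_le. intros Hneg.
    destruct (locally_of_derive f t (f' t) (fun z => z < 0) (Hf t)) as [eta Heta].
    { now apply (open_lt 0). }
    set (s := Rmax 0 (t - eta / 2)).
    assert (Hs : 0 <= s < t /\ t - eta / 2 <= s).
    { unfold s, Rmax. destruct (Rle_dec 0 (t - eta / 2)); destruct eta; simpl in *; lra. }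
    assert (f s < 0).
    { apply Heta. apply Rabs_def1; unfold minus, plus, opp; simpl;
        destruct eta; simpl in *; lra. }
    specialize (Hpos s (proj1 Hs)). lra.
  - apply Rnot_lt_le. intros Hpos'.
    destruct (derive_pos_locally f t (f' t) (Hf t) Hpos') as [eta Heta].
    set (s := Rmax 0 (t - eta / 2)).
    assert (Hs : 0 <= s < t /\ t - eta / 2 <= s).
    { unfold s, Rmax. destruct (Rle_dec 0 (t - eta / 2)); destruct eta; simpl in *; lra. }
    assert (f s < f t).
    { apply (Heta s); [apply Rabs_def1 |]; destruct eta; simpl in *; lra. }
    specialize (Hpos s (proj1 Hs)). lra.
Qed.

Lemma periodic_not_monotone (f f' : R -> R) (T : R) :
  0 < T -> (forall s, is_derive f s (f' s)) -> (forall s, 0 <= f' s) ->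
  0 < f' 0 -> f T = f 0 -> False.
Proof.
  intros HT Hf Hnn H0 Hper.
  destruct (derive_pos_locally f 0 (f' 0) (Hf 0) H0) as [eta Heta].
  set (s := Rmin T (eta / 2)).
  assert (Hs : 0 < s <= T /\ s < eta).
  { unfold s, Rmin. destruct (Rle_dec T (eta / 2)); destruct eta; simpl in *; lra. }
  assert (f 0 < f s) by (apply (Heta s); [apply Rabs_def1 |]; lra).
  assert (f s <= f T).
  { apply (nondecreasing_of_derive f f'); [lra | auto | auto]. }
  lra.
Qed.

(** * Growth of polynomials *)

Lemma sum_abs_le_top_power (c : nat -> R) (k : nat) (m : R) :
  1 <= Rabs m ->
  Rabs (sum_f_R0 (fun i => c i * m ^ i) k) <=
  sum_f_R0 (fun i => Rabs (c i)) k * Rabs m ^ k.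
Proof.
  intros Hm. induction k as [| k IH].
  - simpl. rewrite Rmult_1_r. lra.
  - rewrite !tech5.
    eapply Rle_trans; [apply Rabs_triang |].
    rewrite Rabs_mult, <- RPow_abs.
    assert (0 <= sum_f_R0 (fun i => Rabs (c i)) k).
    { apply cond_pos_sum. intros; apply Rabs_pos. }
    assert (0 <= Rabs m ^ k) by (apply pow_le; lra).
    assert (Rabs m ^ k <= Rabs m ^ S k) by (simpl; nra).
    nra.
Qed.

Lemma leading_term_dominates (c : nat -> R) (k : nat) :
  c k <> 0 ->
  exists A, 1 <= A /\ forall m, A <= Rabs m ->
    Rabs (c k) / 2 * Rabs m ^ k <= Rabs (sum_f_R0 (fun i => c i * m ^ i) k).
Proof.
  intros Hk. assert (Hpos : 0 < Rabs (c k)) by now apply Rabs_pos_lt.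
  destruct k as [| k].
  - exists 1. split; [lra |]. intros m _. simpl. rewrite !Rmult_1_r. lra.
  - set (S0 := sum_f_R0 (fun i => Rabs (c i)) k).
    assert (HS0 : 0 <= S0) by (apply cond_pos_sum; intros; apply Rabs_pos).
    exists (1 + 2 * S0 / Rabs (c (S k))).
    assert (HA : 0 <= 2 * S0 / Rabs (c (S k))).
    { apply Rmult_le_pos; [lra |]. now apply Rlt_le, Rinv_0_lt_compat. }
    split; [lra |]. intros m Hm.
    rewrite tech5.
    assert (Hlow := sum_abs_le_top_power c k m ltac:(lra)). fold S0 in Hlow.
    set (L := sum_f_R0 (fun i => c i * m ^ i) k) in *.
    assert (Htri : Rabs (c (S k) * m ^ S k) - Rabs L <= Rabs (L + c (S k) * m ^ S k)).
    { assert (H := Rabs_triang_inv (c (S k) * m ^ S k) (- L)).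
      rewrite Rabs_Ropp in H. replace (c (S k) * m ^ S k - - L)
        with (L + c (S k) * m ^ S k) in H by ring. exact H. }
    rewrite Rabs_mult, <- RPow_abs in Htri.
    assert (0 <= Rabs m ^ k) by (apply pow_le; lra).
    assert (HB : 2 * S0 <= Rabs (c (S k)) * Rabs m).
    { apply Rle_trans with (Rabs (c (S k)) * (1 + 2 * S0 / Rabs (c (S k)))).
      - replace (Rabs (c (S k)) * (1 + 2 * S0 / Rabs (c (S k))))
          with (Rabs (c (S k)) + 2 * S0) by (field; lra). lra.
      - apply Rmult_le_compat_l; lra. }
    simpl in Htri |- *. nra.
Qed.

Lemma last_nonzero_index (c : nat -> R) (n i0 : nat) :
  (i0 <= n)%nat -> c i0 <> 0 ->
  exists k, (i0 <= k <= n)%nat /\ c k <> 0 /\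
    forall m, sum_f_R0 (fun i => c i * m ^ i) n = sum_f_R0 (fun i => c i * m ^ i) k.
Proof.
  intros Hle Hi0. induction n as [| n IH].
  - exists 0%nat. replace i0 with 0%nat in * by lia. repeat split; auto.
  - destruct (Req_dec (c (S n)) 0) as [Hz | Hnz].
    + assert (i0 <> S n) by (intros ->; contradiction).
      destruct IH as [k [Hk [Hck Hsum]]]; [lia |].
      exists k. split; [lia |]. split; [exact Hck |]. intros m.
      rewrite tech5, Hz, Rmult_0_l, Rplus_0_r. apply Hsum.
    + exists (S n). split; [lia |]. split; [exact Hnz | reflexivity].
Qed.

(** Every nonzero coefficient gives a lower bound by its power, because the degree is at
    least its index. *)
Lemma polynomial_growth (c : nat -> R) (n i0 : nat) :
  (i0 <= n)%nat -> c i0 <> 0 ->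
  exists kappa A, 0 < kappa /\ 1 <= A /\ forall m, A <= Rabs m ->
    kappa * Rabs m ^ i0 <= Rabs (sum_f_R0 (fun i => c i * m ^ i) n).
Proof.
  intros Hle Hi0.
  destruct (last_nonzero_index c n i0 Hle Hi0) as [k [Hk [Hck Hsum]]].
  destruct (leading_term_dominates c k Hck) as [A [HA Hdom]].
  assert (Hpos : 0 < Rabs (c k)) by now apply Rabs_pos_lt.
  exists (Rabs (c k) / 2), A. split; [lra |]. split; [exact HA |].
  intros m Hm. rewrite Hsum. eapply Rle_trans; [| apply Hdom, Hm].
  apply Rmult_le_compat_l; [lra |]. apply Rle_pow; [lra | lia].
Qed.

(** * Solutions of the equation x'' = F(x, x') and their symmetries *)

Definition motion (F : R -> R -> R) (x y : R -> R) : Prop :=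
  forall t, is_derive x t (y t) /\ is_derive y t (F (x t) (y t)).

(** What the necessity proof retains of a global center. The center lies on the x-axis, so
    all points off this axis have closed orbits, wherever on it the center is. *)
Definition recurrent_off_axis (F : R -> R -> R) : Prop :=
  forall x0 y0, y0 <> 0 -> exists x y T,
    motion F x y /\ x 0 = x0 /\ y 0 = y0 /\ 0 < T /\ x T = x0 /\ y T = y0.

Definition homogeneous (n : nat) (Q : R -> R -> R) : Prop :=
  forall s x y, Q (s * x) (s * y) = s ^ n * Q x y.

Lemma recurrent_central_symmetry (F : R -> R -> R) :
  recurrent_off_axis F -> recurrent_off_axis (fun x y => - F (- x) (- y)).
Proof.
  intros HF x0 y0 Hy0.
  destruct (HF (- x0) (- y0)) as [x [y [T [Hm [Hx [Hy [HT [HxT HyT]]]]]]]]; [lra |].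
  exists (fun t => - x t), (fun t => - y t), T.
  split; [| repeat split; lra].
  intros t. destruct (Hm t) as [Hdx Hdy]. split.
  - now apply (is_derive_opp (V:=R_NormedModule)).
  - rewrite !Ropp_involutive. now apply (is_derive_opp (V:=R_NormedModule)).
Qed.

(** Running time backwards changes y into -y; the orbit is shifted by the period so that it
    still starts at time 0. *)
Lemma recurrent_time_reversal (F : R -> R -> R) :
  recurrent_off_axis F -> recurrent_off_axis (fun x y => F x (- y)).
Proof.
  intros HF x0 y0 Hy0.
  destruct (HF x0 (- y0)) as [x [y [T [Hm [Hx [Hy [HT [HxT HyT]]]]]]]]; [lra |].
  exists (fun t => x (T - t)), (fun t => - y (T - t)), T.
  split; [| rewrite Rminus_0_r, Rminus_diag; repeat split; lra].
  intros t. destruct (Hm (T - t)) as [Hdx Hdy].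
  split.
  - evar_last; [apply (is_derive_comp x (fun t => T - t) t (y (T - t)) (-1)); [exact Hdx |] |].
    + auto_derive; [trivial | ring].
    + unfold scal; simpl; unfold mult; simpl. ring.
  - rewrite Ropp_involutive. evar_last.
    + apply (is_derive_opp (V:=R_NormedModule)).
      apply (is_derive_comp y (fun t => T - t) t (F (x (T - t)) (y (T - t))) (-1)); [exact Hdy |].
      auto_derive; [trivial | ring].
    + unfold scal, opp; simpl; unfold mult; simpl. ring.
Qed.

(** * Obstructions to closed orbits *)

(** Suppose q = Q(1,m) > 0. On the boundary y = mx of the region above the ray, the
    derivative of y - mx is x (delta + x^(n-1) q - m^2), which is positive once x is large.
    In the region x' > mx, so x keeps the initial lower bound M, and it has strictly
    increased after a period. *)
Lemma trapped_above_ray (n : nat) (delta : R) (Q : R -> R -> R) (m : R) :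
  (2 <= n)%nat -> homogeneous n Q ->
  recurrent_off_axis (fun x y => delta * x + Q x y) ->
  0 <= m -> Q 1 m <= 0.
Proof.
  intros Hn Hhom Hrec Hm. apply Rnot_lt_le. intros Hq.
  set (q := Q 1 m) in *.
  (* With w = m^2 - delta + 1, x^(n-1) q >= x q >= q + w^2 > w - 1 = m^2 - delta for x >= M;
     the square makes M >= 1 whatever the sign of w. *)
  set (M := 1 + (m ^ 2 - delta + 1) ^ 2 / q).
  assert (Hd : 0 <= (m ^ 2 - delta + 1) ^ 2 / q).
  { apply Rmult_le_pos; [apply pow2_ge_0 | now apply Rlt_le, Rinv_0_lt_compat]. }
  assert (HM : forall x, M <= x -> 0 < delta + x ^ (n - 1) * q - m ^ 2).
  { intros x Hx. assert (Hx1 : 1 <= x) by (unfold M in Hx; lra).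
    assert (HMq : M * q = q + (m ^ 2 - delta + 1) ^ 2) by (unfold M; field; lra).
    assert (x <= x ^ (n - 1)).
    { rewrite <- (pow_1 x) at 1. apply Rle_pow; [exact Hx1 | lia]. }
    assert (M * q <= x ^ (n - 1) * q) by (apply Rmult_le_compat_r; lra).
    clearbody M. set (w := m ^ 2 - delta + 1) in *.
    assert (0 <= w ^ 2 - w + / 4) by (pose proof (pow2_ge_0 (w - / 2)); lra).
    unfold w in *; lra. }
  assert (HM1 : 1 <= M) by (unfold M; lra).
  destruct (Hrec M (m * M + 1)) as [x [y [T [Hmot [Hx0 [Hy0 [HT [HxT _]]]]]]]]; [nra |].
  set (f := fun t => y t - m * x t).
  set (f' := fun t => (delta * x t + Q (x t) (y t)) - m * y t).
  assert (Hf : forall t, is_derive f t (f' t)).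
  { intros t. destruct (Hmot t) as [Hdx Hdy]. unfold f, f'.
    apply (is_derive_minus (V:=R_NormedModule)); [exact Hdy |]. now apply is_derive_scal. }
  assert (Hgrow : forall t, 0 < t -> (forall s, 0 <= s < t -> 0 < f s) -> M < x t).
  { intros t Ht Hpos.
    (* The inequality x' > m x is integrated with the factor exp (-mt), which gives the bound on x
       before anything is known of its sign. *)
    assert (Hpsi : x 0 * exp (- m * 0) < x t * exp (- m * t)).
    { apply (increasing_of_derive (fun s => x s * exp (- m * s))
               (fun s => f s * exp (- m * s))); [exact Ht | |].
      - intros s _. destruct (Hmot s) as [Hdx _]. unfold f.
        auto_derive; [now exists (y s) |].
        rewrite (is_derive_unique (fun u : R => x u) _ _ Hdx). ring.
      - intros s Hs. apply Rmult_lt_0_compat; [apply Hpos; lra | apply exp_pos]. }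
    rewrite Rmult_0_r, exp_0, Hx0, Rmult_1_r in Hpsi.
    assert (exp (- m * t) <= 1).
    { rewrite <- exp_0. destruct (Req_dec (m * t) 0) as [Hz | Hz].
      - replace (- m * t) with 0 by lra. lra.
      - apply Rlt_le, exp_increasing. nra. }
    assert (0 < exp (- m * t)) by apply exp_pos.
    nra. }
  assert (Hf0 : forall t, 0 <= t -> 0 < f t).
  { apply real_induction.
    - unfold f. rewrite Hx0, Hy0. lra.
    - intros t Ht Hpos. apply Rnot_le_lt. intros Hle.
      destruct (first_zero_derive_nonpos f f' t Ht Hf Hpos Hle) as [Hz Hz'].
      assert (Hxt := Hgrow t Ht Hpos).
      unfold f in Hz. unfold f' in Hz'.
      assert (Hy : y t = x t * m) by lra.
      rewrite Hy in Hz'. replace (Q (x t) (x t * m)) with (x t ^ n * q) in Hz'.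
      2:{ unfold q. rewrite <- Hhom, Rmult_1_r. reflexivity. }
      assert (Hpow : x t ^ n = x t * x t ^ (n - 1)).
      { rewrite tech_pow_Rmult. f_equal. lia. }
      assert (HMt := HM (x t) ltac:(lra)). rewrite Hpow in Hz'. nra.
    - intros t _ Ht. apply (locally_of_derive f t (f' t) (fun z => 0 < z) (Hf t)).
      now apply (open_gt 0). }
  assert (M < x T) by (apply Hgrow; [exact HT | intros; apply Hf0; lra]).
  lra.
Qed.

(** While the orbit is in the strip, (1/y)' <= - kappa y = - kappa x', so 1/y + kappa x does
    not increase. If x went from -2 to -1, then 1/y would lose at least kappa, more than its
    initial value; so the orbit stays in the strip, where x increases, and is not
    closed. *)
Lemma blow_up_in_strip (F : R -> R -> R) (kappa Y0 : R) :
  0 < kappa ->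
  (forall x y, -2 <= x <= -1 -> Y0 <= y -> kappa * y ^ 3 <= F x y) ->
  recurrent_off_axis F -> False.
Proof.
  intros Hk HF Hrec.
  (* 1/Y < kappa is what makes 1/y negative at the far side of the strip; Y - 1 >= Y0 leaves
     room to state y > Y - 1 as an open condition. *)
  set (Y := 1 + Rabs Y0 + / kappa).
  assert (Hik : 0 < / kappa) by now apply Rinv_0_lt_compat.
  assert (HY0 : Y0 <= Rabs Y0) by apply Rle_abs.
  assert (HYpos := Rabs_pos Y0).
  assert (HY : 1 < Y /\ Y0 < Y - 1 /\ / kappa <= Y - 1) by (unfold Y; lra).
  assert (HkY : 1 < kappa * Y).
  { assert (kappa * / kappa = 1) by (field; lra). nra. }
  destruct (Hrec (-2) Y) as [x [y [T [Hmot [Hx0 [Hy0 [HT [HxT _]]]]]]]]; [lra |].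
  set (y' := fun t => F (x t) (y t)).
  assert (Hdx : forall t, is_derive x t (y t)) by apply Hmot.
  assert (Hdy : forall t, is_derive y t (y' t)) by apply Hmot.
  assert (Hin : forall t, 0 <= t -> x t < -1 /\ Y - 1 < y t).
  { apply real_induction.
    - rewrite Hx0, Hy0. lra.
    - intros t Ht Hpos.
      assert (Hx : forall s, 0 <= s <= t -> -2 <= x s).
      { intros s Hs. rewrite <- Hx0.
        apply (nondecreasing_of_derive x y); [lra | auto |].
        intros r Hr. destruct (Hpos r); lra. }
      assert (Hy' : forall s, 0 < s < t -> kappa * y s ^ 3 <= y' s).
      { intros s Hs. assert (Hxs := Hx s ltac:(lra)). destruct (Hpos s); [lra |].
        apply HF; lra. }
      assert (Hy : forall s, 0 <= s <= t -> Y <= y s).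
      { intros s Hs. rewrite <- Hy0.
        apply (nondecreasing_of_derive y y'); [lra | auto |].
        intros r Hr. destruct (Hpos r); [lra |].
        eapply Rle_trans; [| apply Hy'; lra].
        apply Rmult_le_pos; [lra |]. apply pow_le. lra. }
      assert (Hyt := Hy t ltac:(lra)). split; [| lra].
      assert (Hw : - (/ y 0 + kappa * x 0) <= - (/ y t + kappa * x t)).
      { apply (nondecreasing_of_derive (fun s => - (/ y s + kappa * x s))
          (fun s => y' s / y s ^ 2 - kappa * y s)); [lra | |].
        - intros s Hs. assert (Hys := Hy s Hs).
          auto_derive; [repeat split; [now exists (y' s) | lra | now exists (y s)] |].
          rewrite (is_derive_unique (fun u : R => x u) _ _ (Hdx s)),
            (is_derive_unique (fun u : R => y u) _ _ (Hdy s)).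
          field. lra.
        - intros s Hs. assert (Hys := Hy s ltac:(lra)). assert (Hys' := Hy' s Hs).
          assert (kappa * y s <= y' s / y s ^ 2); [| lra].
          apply (Rle_div_r (kappa * y s) (y' s) (y s ^ 2)); [apply pow_lt; lra |]. lra. }
      rewrite Hx0, Hy0 in Hw.
      assert (0 < / y t) by (apply Rinv_0_lt_compat; lra).
      assert (HYk : / Y < kappa).
      { assert (0 < / Y) by (apply Rinv_0_lt_compat; lra).
        assert (Y * / Y = 1) by (field; lra). nra. }
      nra.
    - intros t _ [Hx Hy]. apply filter_and.
      + apply (locally_of_derive x t _ (fun z => z < -1) (Hdx t)). now apply (open_lt (-1)).
      + apply (locally_of_derive y t _ (fun z => Y - 1 < z) (Hdy t)). now apply (open_gt (Y - 1)). }
  assert (x 0 < x T); [| lra].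
  apply (increasing_of_derive x y); [exact HT | auto |].
  intros s Hs. destruct (Hin s); lra.
Qed.

(** * The first integral of x'' = g(x) + h(x) x'^2 *)

(** The integrating factor mu turns the quadratic term h(x) x'^2 into a conservative one:
    y^2 mu(x) / 2 + V(x) is then constant along the solutions. *)
Lemma energy_coefficients (g h : R -> R) :
  (forall x, continuous g x) -> (forall x, continuous h x) ->
  exists mu V : R -> R,
    (forall x, 0 < mu x) /\ mu 0 = 1 /\ V 0 = 0 /\
    (forall x, is_derive mu x (- 2 * h x * mu x)) /\
    (forall x, is_derive V x (- g x * mu x)).
Proof.
  intros Hg Hh.
  assert (Hprim : forall u : R -> R, (forall x, continuous u x) ->
            forall x, is_derive (fun z => RInt u 0 z) x (u x)).
  { intros u Hu x. apply (is_derive_RInt u _ 0 x); [| apply Hu].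
    apply filter_forall. intros z. apply (RInt_correct (V := R_CompleteNormedModule)).
    apply (ex_RInt_continuous (V := R_CompleteNormedModule)). auto. }
  set (I := fun z => RInt h 0 z).
  assert (HI0 : I 0 = 0) by apply (RInt_point (V := R_CompleteNormedModule)).
  assert (HI : forall x, is_derive I x (h x)) by exact (Hprim h Hh).
  clearbody I.
  set (mu := fun x => exp (- 2 * I x)).
  assert (Hmu : forall x, is_derive mu x (- 2 * h x * mu x)).
  { intros x. unfold mu. auto_derive; [eexists; apply HI |].
    rewrite (is_derive_unique (fun u : R => I u) _ _ (HI x)). ring. }
  exists mu, (fun x => RInt (fun s => - g s * mu s) 0 x).
  split; [| split; [| split; [| split]]].
  - intros x. apply exp_pos.
  - unfold mu. rewrite HI0, Rmult_0_r. apply exp_0.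
  - apply (RInt_point (V := R_CompleteNormedModule)).
  - exact Hmu.
  - apply (Hprim (fun s => - g s * mu s)). intros x.
    apply (continuous_mult (K := R_AbsRing)).
    + apply (continuous_opp (V := R_NormedModule)), Hg.
    + apply (ex_derive_continuous (V := R_NormedModule)). eexists. apply Hmu.
Qed.

(** Stated for an arbitrary F, so that it measures the dissipation due to the part of the
    force that is not g + h y^2. *)
Lemma energy_rate (g h mu V : R -> R) (F : R -> R -> R) (x y : R -> R) :
  (forall z, is_derive mu z (- 2 * h z * mu z)) ->
  (forall z, is_derive V z (- g z * mu z)) ->
  motion F x y ->
  forall t, is_derive (fun s => y s ^ 2 * mu (x s) / 2 + V (x s)) t
    (mu (x t) * y t * (F (x t) (y t) - (g (x t) + h (x t) * y t ^ 2))).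
Proof.
  intros Hmu HV Hmot t. destruct (Hmot t) as [Hdx Hdy].
  auto_derive; [repeat split; eexists; eauto |].
  rewrite (is_derive_unique (fun u : R => x u) _ _ Hdx),
    (is_derive_unique (fun u : R => y u) _ _ Hdy),
    (is_derive_unique (fun u : R => mu u) _ _ (Hmu (x t))),
    (is_derive_unique (fun u : R => V u) _ _ (HV (x t))).
  field.
Qed.

(** For c <> 0 a term c e(x) y with e >= 0 makes the first integral monotone along every orbit, and
    strictly so near (1,1), so that the orbit of this point cannot be closed. *)
Lemma no_one_signed_damping (g h e : R -> R) :
  (forall x, continuous g x) -> (forall x, continuous h x) ->
  (forall x, 0 <= e x) -> 0 < e 1 ->
  forall c, recurrent_off_axis (fun x y => g x + h x * y ^ 2 + c * e x * y) -> c = 0.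
Proof.
  intros Hg Hh He He1 c Hrec.
  destruct (energy_coefficients g h Hg Hh) as [mu [V [Hpos [_ [_ [Hmu HV]]]]]].
  destruct (Hrec 1 1) as [x [y [T [Hmot [Hx0 [Hy0 [HT [HxT HyT]]]]]]]]; [lra |].
  destruct (Req_dec c 0) as [| Hc]; [assumption | exfalso].
  assert (Hrate := energy_rate g h mu V _ x y Hmu HV Hmot).
  apply (periodic_not_monotone
    (fun s => c * (y s ^ 2 * mu (x s) / 2 + V (x s)))
    (fun s => c ^ 2 * (e (x s) * mu (x s) * y s ^ 2)) T HT).
  - intros s. evar_last; [apply is_derive_scal, Hrate |]. ring.
  - intros s. apply Rmult_le_pos; [apply pow2_ge_0 |].
    apply Rmult_le_pos; [| apply pow2_ge_0].
    apply Rmult_le_pos; [apply He | apply Rlt_le, Hpos].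
  - rewrite Hx0, Hy0. assert (0 < c ^ 2) by (apply pow2_gt_0, Hc).
    assert (0 < e 1 * mu 1) by (apply Rmult_lt_0_compat; [exact He1 | apply Hpos]). nra.
  - now rewrite HxT, HyT, Hx0, Hy0.
Qed.

(** For g = 0 the potential V is constant, so the first integral reduces to y^2 mu(x) / 2,
    which vanishes on the x-axis. *)
Lemma stationary_without_restoring_force (h : R -> R) (F : R -> R -> R) (x y : R -> R) :
  (forall z, continuous h z) -> (forall u v, F u v = h u * v ^ 2) ->
  motion F x y -> y 0 = 0 -> forall t, x t = x 0 /\ y t = y 0.
Proof.
  intros Hh HF Hmot Hy0.
  destruct (energy_coefficients (fun _ => 0) h) as [mu [V [Hpos [_ [_ [Hmu HV]]]]]];
    [intros; apply continuous_const | exact Hh |].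
  assert (HVc : forall u v, V u = V v).
  { apply constant_of_derive. intros s. evar_last; [apply HV | ring]. }
  assert (HE := energy_rate (fun _ => 0) h mu V F x y Hmu HV Hmot).
  assert (Hyz : forall t, y t = 0).
  { intros t.
    assert (H : y t ^ 2 * mu (x t) / 2 + V (x t) = y 0 ^ 2 * mu (x 0) / 2 + V (x 0)).
    { apply (constant_of_derive (fun s => y s ^ 2 * mu (x s) / 2 + V (x s))).
      intros s. evar_last; [apply HE |]. simpl. rewrite HF. ring. }
    rewrite (HVc (x t) (x 0)), Hy0 in H. assert (Hm := Hpos (x t)).
    assert (y t ^ 2 * mu (x t) = 0) by lra.
    assert (Hsq : y t ^ 2 = 0) by nra. nra. }
  intros t. split; [| now rewrite Hyz, Hy0].
  apply (constant_of_derive x). intros s. destruct (Hmot s) as [Hdx _].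
  rewrite Hyz in Hdx. exact Hdx.
Qed.

(** * Necessity *)

Definition kukles_form (n : nat) (a : nat -> nat -> R) (x y : R) : R :=
  sum_f_R0 (fun i => a (n - i)%nat i * x ^ (n - i) * y ^ i) n.

Lemma kukles_form_homogeneous (n : nat) (a : nat -> nat -> R) :
  homogeneous n (kukles_form n a).
Proof.
  intros s x y. unfold kukles_form. rewrite scal_sum. apply sum_eq. intros i Hi.
  rewrite !Rpow_mult_distr.
  replace (s ^ n) with (s ^ (n - i) * s ^ i); [ring |].
  rewrite <- pow_add. f_equal. lia.
Qed.

Lemma kukles_form_ray (n : nat) (a : nat -> nat -> R) (m : R) :
  kukles_form n a 1 m = sum_f_R0 (fun i => a (n - i)%nat i * m ^ i) n.
Proof.
  apply sum_eq. intros i _. rewrite pow1. ring.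
Qed.

Lemma sum_first_three (u : nat -> R) (n : nat) :
  (2 <= n)%nat -> (forall i, (3 <= i <= n)%nat -> u i = 0) ->
  sum_f_R0 u n = u 0%nat + u 1%nat + u 2%nat.
Proof.
  intros Hn Hu. induction n as [| n IH]; [lia |].
  destruct (Nat.eq_dec n 1) as [-> | Hn1]; [reflexivity |].
  rewrite tech5, IH, (Hu (S n)); [ring | lia | lia |].
  intros i Hi. apply Hu. lia.
Qed.

Lemma global_center_recurrent (X : R * R -> R * R) (F : R -> R -> R) :
  (forall x y, X (x, y) = (y, F x y)) ->
  has_global_center X -> recurrent_off_axis F.
Proof.
  intros HX [[px py] [[Heq _] Hall]] x0 y0 Hy0.
  unfold equilibrium in Heq. rewrite HX in Heq. injection Heq as Hpy _.
  destruct (Hall (x0, y0)) as [g [T [Hsol [Hg0 [HT [Hper _]]]]]].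
  { intros H. injection H as _ H. lra. }
  exists (fun t => fst (g t)), (fun t => snd (g t)), T.
  specialize (Hper 0). rewrite Rplus_0_l in Hper. rewrite Hper, Hg0.
  split; [| now auto]. intros t. destruct (Hsol t) as [H1 H2].
  rewrite (surjective_pairing (g t)), HX in H1, H2. split; assumption.
Qed.

(** In even degree the central symmetry replaces Q by -Q, so the trapping argument applies
    to both signs and leaves only Q = 0. *)
Lemma even_degree_impossible (n : nat) (delta : R) (a : nat -> nat -> R) (i0 : nat) :
  (2 <= n)%nat -> Nat.Even n -> (i0 <= n)%nat -> a (n - i0)%nat i0 <> 0 ->
  ~ recurrent_off_axis (fun x y => delta * x + kukles_form n a x y).
Proof.
  intros Hn Heven Hi0 Ha Hrec. set (Q := kukles_form n a) in *.
  assert (Hhom : homogeneous n Q) by apply kukles_form_homogeneous.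
  assert (Hup : forall m, 0 <= m -> Q 1 m <= 0).
  { intros m Hm. exact (trapped_above_ray n delta Q m Hn Hhom Hrec Hm). }
  assert (Hdown : forall m, 0 <= m -> 0 <= Q 1 m).
  { intros m Hm.
    assert (H : - Q (- (1)) (- m) <= 0).
    { apply (trapped_above_ray n delta (fun x y => - Q (- x) (- y))); [exact Hn | | | exact Hm].
      - intros s x y. rewrite <- !Ropp_mult_distr_r_reverse, Hhom. ring.
      - apply recurrent_central_symmetry in Hrec.
        intros x0 y0 Hy0. destruct (Hrec x0 y0 Hy0) as [x [y [T [Hmot H]]]].
        exists x, y, T. split; [| exact H]. intros t. destruct (Hmot t) as [H1 H2].
        split; [exact H1 |]. evar_last; [exact H2 | ring]. }
    replace (Q (- (1)) (- m)) with (Q 1 m) in H; [lra |].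
    replace (- (1)) with (-1 * 1) by ring. replace (- m) with (-1 * m) by ring.
    rewrite Hhom. destruct Heven as [k ->]. rewrite pow_1_even. ring. }
  destruct (polynomial_growth (fun i => a (n - i)%nat i) n i0 Hi0 Ha)
    as [kappa [A [Hk [HA Hgrow]]]].
  assert (HRA : Rabs A = A) by (apply Rabs_pos_eq; lra).
  specialize (Hgrow A). rewrite <- kukles_form_ray, HRA in Hgrow. fold Q in Hgrow.
  replace (Q 1 A) with 0 in Hgrow.
  - rewrite Rabs_R0 in Hgrow. assert (HAi : 0 < A ^ i0) by (apply pow_lt; lra).
    specialize (Hgrow ltac:(lra)). nra.
  - apply Rle_antisym; [apply Hdown | apply Hup]; lra.
Qed.

Lemma odd_degree_nonpositive (n : nat) (delta : R) (a : nat -> nat -> R) (m : R) :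
  (2 <= n)%nat -> Nat.Odd n ->
  recurrent_off_axis (fun x y => delta * x + kukles_form n a x y) ->
  kukles_form n a 1 m <= 0.
Proof.
  intros Hn Hodd Hrec.
  assert (Hhom := kukles_form_homogeneous n a).
  destruct (Rle_lt_dec 0 m) as [Hm | Hm].
  - exact (trapped_above_ray n delta _ m Hn Hhom Hrec Hm).
  - apply recurrent_time_reversal in Hrec.
    rewrite <- (Ropp_involutive m).
    apply (trapped_above_ray n delta (fun x y => kukles_form n a x (- y)));
      [exact Hn | | exact Hrec | lra].
    intros s x y. now rewrite <- Ropp_mult_distr_r_reverse, Hhom.
Qed.

(** In odd degree the form is nonnegative for x < 0, as q <= 0; a coefficient of index
    i >= 3 then makes it at least cubic in y on the strip -2 <= x <= -1. *)
Lemma high_powers_of_y_vanish (n : nat) (delta : R) (a : nat -> nat -> R) (i : nat) :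
  (2 <= n)%nat -> Nat.Odd n -> delta <= 0 ->
  recurrent_off_axis (fun x y => delta * x + kukles_form n a x y) ->
  (3 <= i <= n)%nat -> a (n - i)%nat i = 0.
Proof.
  intros Hn Hodd Hdelta Hrec Hi. apply NNPP. intros Hne.
  assert (Hq := fun m => odd_degree_nonpositive n delta a m Hn Hodd Hrec).
  destruct (polynomial_growth (fun i => a (n - i)%nat i) n i (proj2 Hi) Hne)
    as [kappa [A [Hk [HA Hgrow]]]].
  apply (blow_up_in_strip (fun x y => delta * x + kukles_form n a x y) (kappa / 8) (2 * A));
    [lra | | exact Hrec].
  intros x y Hx Hy.
  set (m := y / x).
  assert (Hxy : y = x * m) by (unfold m; field; lra).
  assert (Habs : Rabs m = y / - x).
  { unfold m. rewrite Rabs_left; [field; lra |].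
    apply Rmult_pos_neg; [lra | apply Rinv_lt_0_compat; lra]. }
  assert (Hm : y / 2 <= Rabs m).
  { rewrite Habs. apply Rmult_le_compat_l; [lra |]. apply Rinv_le_contravar; lra. }
  assert (Hlow := Hgrow m ltac:(lra)). rewrite <- kukles_form_ray in Hlow.
  assert (Hq' : kappa * (y / 2) ^ 3 <= - kukles_form n a 1 m).
  { rewrite <- Rabs_left1 by apply Hq. eapply Rle_trans; [| exact Hlow].
    apply Rmult_le_compat_l; [lra |].
    apply Rle_trans with (Rabs m ^ 3); [apply pow_incr; lra |].
    apply Rle_pow; [lra | lia]. }
  assert (Hpow : x ^ n <= -1).
  { replace x with (-1 * - x) by ring. rewrite Rpow_mult_distr.
    destruct Hodd as [k ->]. rewrite Nat.add_1_r, pow_1_odd.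
    assert (1 <= (- x) ^ S (2 * k)) by (apply pow_R1_Rle; lra). lra. }
  assert (HQ : kukles_form n a x y = x ^ n * kukles_form n a 1 m).
  { rewrite <- (kukles_form_homogeneous n a x 1 m), Rmult_1_r, <- Hxy. reflexivity. }
  rewrite HQ. assert (Hqm := Hq m).
  assert (0 <= delta * x) by nra.
  assert (- kukles_form n a 1 m <= x ^ n * kukles_form n a 1 m) by nra.
  assert (kappa / 8 * y ^ 3 = kappa * (y / 2) ^ 3) by field. lra.
Qed.

(** Two equilibria on the x-axis cannot both be the center. *)
Lemma not_all_fixed_global_center (X : R * R -> R * R) :
  (forall g x0, solution X g -> g 0 = (x0, 0) -> forall t, g t = g 0) ->
  ~ has_global_center X.
Proof.
  intros Hfix [p [_ Hall]].
  assert (Hout : forall x0, (x0, 0) = p).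
  { intros x0. apply NNPP. intros Hne.
    destruct (Hall _ Hne) as [g [T [Hsol [Hg0 [_ [_ [t Ht]]]]]]].
    exact (Ht (Hfix g x0 Hsol Hg0 t)). }
  assert (H := eq_trans (Hout 1) (eq_sym (Hout 2))). injection H. lra.
Qed.

Lemma global_center_necessary (n : nat) (delta : R) (a : nat -> nat -> R) :
  (2 <= n)%nat -> delta <= 0 ->
  (exists i : nat, (i <= n)%nat /\ a (n - i)%nat i <> 0) ->
  has_global_center (kukles n delta a) ->
  (forall p : R * R,
      kukles n delta a p = kukles_even n delta (a n 0%nat) (a (n - 2)%nat 2%nat) p) /\
   Nat.Odd n /\ a n 0%nat <= 0 /\ a (n - 2)%nat 2%nat <= 0 /\
   delta ^ 2 + (a n 0%nat) ^ 2 <> 0.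
Proof.
  intros Hn Hdelta [i0 [Hi0 Ha]] Hgc.
  assert (Hrec : recurrent_off_axis (fun x y => delta * x + kukles_form n a x y)).
  { now apply (global_center_recurrent (kukles n delta a)). }
  assert (Hodd : Nat.Odd n).
  { destruct (Nat.Even_or_Odd n) as [Heven | Hodd]; [exfalso | exact Hodd].
    exact (even_degree_impossible n delta a i0 Hn Heven Hi0 Ha Hrec). }
  assert (Hzero := fun i => high_powers_of_y_vanish n delta a i Hn Hodd Hdelta Hrec).
  assert (Hq := fun m => odd_degree_nonpositive n delta a m Hn Hodd Hrec).
  assert (Hj : exists j, n = (2 * j + 3)%nat).
  { destruct Hodd as [k Hk]. exists (k - 1)%nat. lia. }
  destruct Hj as [j Hj].
  set (a0 := a n 0%nat). set (a2 := a (n - 2)%nat 2%nat). set (a1 := a (n - 1)%nat 1%nat).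
  assert (Hform : forall x y, kukles_form n a x y =
            a0 * x ^ n + a1 * x ^ (n - 1) * y + a2 * x ^ (n - 2) * y ^ 2).
  { intros x y. unfold kukles_form. rewrite sum_first_three; [| exact Hn |].
    - rewrite Nat.sub_0_r. unfold a0, a1, a2. ring.
    - intros i Hi. rewrite Hzero by exact Hi. ring. }
  assert (Hray : forall m, a0 + a1 * m + a2 * m ^ 2 <= 0).
  { intros m. specialize (Hq m). rewrite Hform, !pow1 in Hq. lra. }
  assert (Ha0 : a0 <= 0) by (specialize (Hray 0); lra).
  assert (Ha2 : a2 <= 0).
  { apply Rnot_lt_le. intros Hpos.
    (* The half-sum of the inequalities at m and -m is a0 + a2 m^2 <= 0, and this m has
       a2 m = a2 - a0 and m >= 1, hence a2 m^2 >= a2 - a0 > - a0. *)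
    set (m := 1 - a0 / a2).
    assert (H1 := Hray m). assert (H2 := Hray (- m)).
    assert (Hm : a2 * m = a2 - a0) by (unfold m; field; lra).
    assert (1 <= m) by nra. nra. }
  assert (Hcont : forall c k x, continuous (fun z : R => c * z ^ k) x).
  { intros c k x. apply (ex_derive_continuous (V := R_NormedModule)). now auto_derive. }
  assert (Ha1 : a1 = 0).
  { apply (no_one_signed_damping (fun x => delta * x + a0 * x ^ n) (fun x => a2 * x ^ (n - 2))
             (fun x => x ^ (n - 1))).
    - intros x. apply (ex_derive_continuous (V := R_NormedModule)). now auto_derive.
    - intros x. apply Hcont.
    - intros x. replace (n - 1)%nat with (2 * S j)%nat by lia. rewrite pow_mult.
      apply pow_le, pow2_ge_0.
    - rewrite pow1. lra.
    - intros x0 y0 Hy0. destruct (Hrec x0 y0 Hy0) as [x [y [T [Hmot H]]]].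
      exists x, y, T. split; [| exact H]. intros t. destruct (Hmot t) as [H1 H2].
      split; [exact H1 |]. evar_last; [exact H2 |]. rewrite Hform. ring. }
  split; [| split; [exact Hodd | split; [exact Ha0 | split; [exact Ha2 |]]]].
  - intros [x y]. unfold kukles, kukles_even. f_equal.
    change (delta * x + kukles_form n a x y = delta * x + a0 * x ^ n + a2 * x ^ (n - 2) * y ^ 2).
    rewrite Hform, Ha1. ring.
  - intros Hsum. assert (Hd0 : delta = 0) by nra. assert (Ha00 : a0 = 0) by nra.
    revert Hgc. apply not_all_fixed_global_center. intros g x0 Hsol Hg0 t.
    assert (Hfix := stationary_without_restoring_force (fun x => a2 * x ^ (n - 2))
      (fun x y => delta * x + kukles_form n a x y)
      (fun t => fst (g t)) (fun t => snd (g t))).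
    destruct Hfix with (t := t) as [H1 H2].
    + intros z. apply Hcont.
    + intros u v. rewrite Hform, Ha1, Hd0, Ha00. ring.
    + intros s. specialize (Hsol s). rewrite (surjective_pairing (g s)) in Hsol. exact Hsol.
    + now rewrite Hg0.
    + now rewrite (surjective_pairing (g t)), (surjective_pairing (g 0)), H1, H2.
Qed.

(** * Implicit and inverse functions of one variable *)

Lemma ball_Rabs (x e y : R) : ball x e y <-> Rabs (y - x) < e.
Proof. reflexivity. Qed.

Lemma strictly_increasing_of_derive (f f' : R -> R) :
  (forall s, is_derive f s (f' s)) -> (forall s, 0 < f' s) ->
  forall u v, u < v <-> f u < f v.
Proof.
  intros Hf Hpos.
  assert (Hinc : forall u v, u < v -> f u < f v).
  { intros u v Huv. now apply (increasing_of_derive f f'). }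
  intros u v. split; [apply Hinc |]. intros Hlt.
  destruct (Rtotal_order u v) as [Huv | [-> | Hvu]]; [exact Huv | lra |].
  specialize (Hinc v u Hvu). lra.
Qed.

Lemma implicit_continuous (F Fu Fs : R -> R -> R) (r : R -> R) (c : R) :
  (forall u s, is_derive (fun u => F u s) u (Fu u s)) ->
  (forall u s, is_derive (fun s => F u s) s (Fs u s)) ->
  (forall u s, 0 < Fs u s) ->
  (forall u, F u (r u) = c) ->
  forall u, continuous r u.
Proof.
  intros HFu HFs Hpos Hr u.
  assert (Hlt : forall w s1 s2, s1 < s2 <-> F w s1 < F w s2).
  { intros w. now apply (strictly_increasing_of_derive _ (Fs w)). }
  apply (filterlim_locally (F := locally u) r (r u)). intros eps.
  assert (He := cond_pos eps).
  assert (H1 : F u (r u - eps) < c) by (rewrite <- (Hr u); apply (proj1 (Hlt u _ _)); lra).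
  assert (H2 : c < F u (r u + eps)) by (rewrite <- (Hr u); apply (proj1 (Hlt u _ _)); lra).
  apply filter_imp with
    (fun w => F w (r u - eps) < c /\ c < F w (r u + eps)).
  - intros w [Hw1 Hw2]. rewrite <- (Hr w) in Hw1, Hw2.
    apply (proj2 (Hlt w _ _)) in Hw1. apply (proj2 (Hlt w _ _)) in Hw2.
    apply Rabs_def1; unfold minus, plus, opp; simpl; lra.
  - apply filter_and.
    + apply (locally_of_derive (fun w => F w (r u - eps)) u _ (fun z => z < c) (HFu u _)).
      now apply (open_lt c).
    + apply (locally_of_derive (fun w => F w (r u + eps)) u _ (fun z => c < z) (HFu u _)).
      now apply (open_gt c).
Qed.

(** An implicit function theorem in which the solution r is already given globally. By the
    mean value theorem in the second variable, the difference quotient of r is minus the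
    one of F(., r u) divided by Fs at an intermediate point xi, which tends to r u. *)
Lemma implicit_derive (F Fu Fs : R -> R -> R) (r : R -> R) (c : R) :
  (forall u s, is_derive (fun u => F u s) u (Fu u s)) ->
  (forall u s, is_derive (fun s => F u s) s (Fs u s)) ->
  (forall u s, continuity_2d_pt Fs u s) ->
  (forall u s, 0 < Fs u s) ->
  (forall u, F u (r u) = c) ->
  forall u, is_derive r u (- Fu u (r u) / Fs u (r u)).
Proof.
  intros HFu HFs Hcont Hpos Hr u.
  assert (Hrc := implicit_continuous F Fu Fs r c HFu HFs Hpos Hr u).
  assert (Hxi : forall h, exists xi, Rabs (xi - r u) <= Rabs (r (u + h) - r u) /\
            F (u + h) (r (u + h)) - F (u + h) (r u) = Fs (u + h) xi * (r (u + h) - r u)).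
  { intros h.
    destruct (MVT_gen (F (u + h)) (r u) (r (u + h)) (Fs (u + h))) as [xi [Hb Heq]].
    - intros s _. apply HFs.
    - intros s _. apply continuity_pt_filterlim.
      apply (ex_derive_continuous (V := R_NormedModule)). eexists. apply HFs.
    - exists xi. split; [| exact Heq].
      unfold Rmin, Rmax in Hb. destruct (Rle_dec (r u) (r (u + h))).
      + rewrite !Rabs_pos_eq; lra.
      + rewrite !Rabs_left1; lra. }
  apply functional_choice in Hxi. destruct Hxi as [xi Hxi].
  assert (Hslope : is_lim (fun h => - ((F (u + h) (r u) - F u (r u)) / h) / Fs (u + h) (xi h))
                     0 (- Fu u (r u) / Fs u (r u))).
  { assert (Hne : Fs u (r u) <> 0) by (specialize (Hpos u (r u)); lra).
    apply (is_lim_div _ _ 0 (- Fu u (r u)) (Fs u (r u))).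
    - apply (is_lim_opp _ 0 (Fu u (r u))). apply is_lim_spec. intros eps.
      assert (HD := HFu u (r u)). apply is_derive_Reals in HD.
      destruct (HD eps (cond_pos eps)) as [eta Heta].
      exists eta. intros h Hh Hh0. apply Heta; [exact Hh0 |].
      apply (proj1 (ball_Rabs 0 eta h)) in Hh. now rewrite Rminus_0_r in Hh.
    - apply is_lim_spec. intros eps.
      destruct (Hcont u (r u) eps) as [eta1 H1].
      destruct (proj1 (filterlim_locally (F := locally u) r (r u)) Hrc eta1) as [eta2 H2].
      exists (mkposreal (Rmin eta1 eta2) (Rmin_stable_in_posreal eta1 eta2)).
      intros h Hh _.
      apply (proj1 (ball_Rabs 0 _ h)) in Hh. rewrite Rminus_0_r in Hh. simpl in Hh.
      assert (Hm1 := Rmin_l eta1 eta2). assert (Hm2 := Rmin_r eta1 eta2).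
      apply H1.
      + rewrite Rplus_minus_l. lra.
      + eapply Rle_lt_trans; [apply Hxi |].
        apply (proj1 (ball_Rabs _ _ _)), H2, (proj2 (ball_Rabs _ _ _)). rewrite Rplus_minus_l. lra.
    - intros H. apply Hne. now injection H.
    - exact I. }
  apply is_derive_Reals. intros eps Heps.
  apply is_lim_spec in Hslope. destruct (Hslope (mkposreal eps Heps)) as [eta Heta].
  exists eta. intros h Hh0 Hh.
  assert (Hq : (r (u + h) - r u) / h =
               - ((F (u + h) (r u) - F u (r u)) / h) / Fs (u + h) (xi h)).
  { destruct (Hxi h) as [_ Heq]. rewrite Hr, <- (Hr u) in Heq.
    assert (Hp := Hpos (u + h) (xi h)).
    replace (F (u + h) (r u) - F u (r u)) with (- (Fs (u + h) (xi h) * (r (u + h) - r u))) by lra.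
    field. lra. }
  rewrite Hq. apply Heta; [| exact Hh0].
  apply (proj2 (ball_Rabs 0 eta h)). now rewrite Rminus_0_r.
Qed.

(** The inverse of tau solves tau s - t = 0, so this is an instance of the implicit
    function theorem. *)
Lemma increasing_inverse_derive (tau k : R -> R) :
  (forall s, is_derive tau s (k s)) -> (forall s, continuous k s) ->
  (forall s, 0 < k s) -> (forall t, exists s, tau s = t) ->
  exists sigma : R -> R,
    (forall t, tau (sigma t) = t) /\ (forall t, is_derive sigma t (/ k (sigma t))).
Proof.
  intros Htau Hk Hpos Hsurj.
  destruct (functional_choice _ Hsurj) as [sigma Hsigma].
  exists sigma. split; [exact Hsigma |]. intros t.
  evar_last.
  - apply (implicit_derive (fun t s => tau s - t) (fun _ _ => -1) (fun _ s => k s) sigma 0).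
    + intros u s. auto_derive; [trivial | ring].
    + intros u s. auto_derive; [eexists; apply Htau |].
      rewrite (is_derive_unique (fun z : R => tau z) _ _ (Htau s)). ring.
    + intros u s. apply (continuity_1d_2d_pt_comp k (fun _ s => s)).
      * apply continuity_pt_filterlim, Hk.
      * apply continuity_2d_pt_id2.
    + intros _ s. apply Hpos.
    + intros u. rewrite Hsigma. ring.
  - simpl. field. specialize (Hpos (sigma t)). lra.
Qed.

(** * Periodic solutions from closed curves *)

(** The closed curve (X, Y) is tangent to the vector field, with k the time spent per unit of
    parameter. The time tau elapsed since parameter 0 is a bijection of the line that
    commutes with the period up to the shift T, and its inverse reparametrizes the curve
    into a solution. *)
Lemma motion_along_closed_curve (F : R -> R -> R) (X Y k : R -> R) (P : R) :
  0 < P -> (forall s, continuous k s) -> (forall s, 0 < k s) ->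
  (forall s, X (s + P) = X s) -> (forall s, Y (s + P) = Y s) ->
  (forall s, k (s + P) = k s) ->
  (forall s, is_derive X s (k s * Y s)) ->
  (forall s, is_derive Y s (k s * F (X s) (Y s))) ->
  forall s0, exists x y T,
    motion F x y /\ x 0 = X s0 /\ y 0 = Y s0 /\ 0 < T /\
    forall t, x (t + T) = x t /\ y (t + T) = y t.
Proof.
  intros HP Hk Hpos HXP HYP HkP HX HY s0.
  set (tau := (fun z => RInt k 0 z) : R -> R).
  assert (Htau : forall s, is_derive tau s (k s)).
  { intros s. apply (is_derive_RInt k _ 0 s); [| apply Hk].
    apply filter_forall. intros z. apply (RInt_correct (V := R_CompleteNormedModule)).
    apply (ex_RInt_continuous (V := R_CompleteNormedModule)). auto. }
  assert (Htau0 : tau 0 = 0) by apply (RInt_point (V := R_CompleteNormedModule)).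
  clearbody tau.
  assert (Hinc := strictly_increasing_of_derive tau k Htau Hpos).
  set (T := tau P).
  assert (HT : 0 < T) by (unfold T; rewrite <- Htau0; exact (proj1 (Hinc 0 P) HP)).
  assert (Hshift : forall s, tau (s + P) = tau s + T).
  { intros s.
    assert (H : tau (s + P) - tau s = tau (0 + P) - tau 0).
    { apply (constant_of_derive (fun s => tau (s + P) - tau s)).
      intros w. auto_derive; [repeat split; eexists; apply Htau |].
      rewrite (is_derive_unique (fun z : R => tau z) _ _ (Htau (w + P))),
        (is_derive_unique (fun z : R => tau z) _ _ (Htau w)), HkP. ring. }
    rewrite Rplus_0_l, Htau0 in H. fold T in H. lra. }
  assert (Hshifts : forall (N : nat) s, tau (s + INR N * P) = tau s + INR N * T).
  { induction N as [| N IH]; intros s.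
    - simpl. rewrite !Rmult_0_l, !Rplus_0_r. reflexivity.
    - rewrite S_INR. replace (s + (INR N + 1) * P) with (s + INR N * P + P) by ring.
      rewrite Hshift, IH. lra. }
  assert (Hsurj : forall t, exists s, tau s = t).
  { intros t. destruct (nfloor_ex (Rabs t / T)) as [N [_ HN]].
    { apply Rmult_le_pos; [apply Rabs_pos | apply Rlt_le, Rinv_0_lt_compat, HT]. }
    assert (HtN : Rabs t <= INR (S N) * T).
    { rewrite S_INR. exact (Rlt_le _ _ (proj1 (Rlt_div_l _ _ _ HT) HN)). }
    assert (H1 := Hshifts (S N) 0). assert (H2 := Hshifts (S N) (- (INR (S N) * P))).
    rewrite Rplus_0_l, Htau0 in H1. rewrite Rplus_opp_l, Htau0 in H2.
    assert (Hab := Rabs_maj2 t). assert (Hab' := Rle_abs t).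
    destruct (IVT_gen tau (- (INR (S N) * P)) (INR (S N) * P) t) as [s [_ Hs]].
    - intros s. apply continuity_pt_filterlim, (ex_derive_continuous (V := R_NormedModule)).
      eexists. apply Htau.
    - split; [eapply Rle_trans; [apply Rmin_l |] | eapply Rle_trans; [| apply Rmax_r]]; lra.
    - now exists s. }
  destruct (increasing_inverse_derive tau k Htau Hk Hpos Hsurj) as [sigma [Hinv Hsigma]].
  assert (Hinj : forall s1 s2, tau s1 = tau s2 -> s1 = s2).
  { intros s1 s2 Heq. destruct (Rtotal_order s1 s2) as [H | [H | H]];
      [| exact H |]; apply (proj1 (Hinc _ _)) in H; lra. }
  assert (Hlift : forall t, sigma (t + T) = sigma t + P).
  { intros t. apply Hinj. now rewrite Hshift, !Hinv. }
  assert (Hstart : sigma (0 + tau s0) = s0).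
  { apply Hinj. rewrite Hinv. ring. }
  exists (fun t => X (sigma (t + tau s0))), (fun t => Y (sigma (t + tau s0))), T.
  rewrite Hstart. split; [| split; [reflexivity | split; [reflexivity | split; [exact HT |]]]].
  - intros t. set (s := sigma (t + tau s0)).
    assert (Hks := Hpos s).
    assert (Hd : is_derive (fun t => sigma (t + tau s0)) t (/ k s)).
    { auto_derive; [eexists; apply Hsigma |].
      rewrite (is_derive_unique (fun z : R => sigma z) _ _ (Hsigma _)).
      fold s. ring. }
    split.
    + evar_last; [apply (is_derive_comp X (fun t => sigma (t + tau s0)) t _ _ (HX s) Hd) |].
      unfold scal; simpl; unfold mult; simpl. field. lra.
    + evar_last; [apply (is_derive_comp Y (fun t => sigma (t + tau s0)) t _ _ (HY s) Hd) |].
      unfold scal; simpl; unfold mult; simpl. field. lra.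
  - intros t. replace (t + T + tau s0) with (t + tau s0 + T) by ring.
    now rewrite Hlift, HXP, HYP.
Qed.

(** The angle is measured clockwise from the y-axis, the direction in which the orbits
    turn, and the radius is written exp v so that v ranges over the whole line. *)
Lemma polar_coordinates (x y : R) :
  (x, y) <> (0, 0) -> exists v th, x = exp v * sin th /\ y = exp v * cos th.
Proof.
  intros Hne.
  assert (Hpos : 0 < x ^ 2 + y ^ 2).
  { destruct (Req_dec x 0) as [-> | Hx].
    - destruct (Req_dec y 0) as [-> | Hy]; [now elim Hne |].
      assert (0 < y ^ 2) by now apply pow2_gt_0. lra.
    - assert (0 < x ^ 2) by now apply pow2_gt_0. pose proof (pow2_ge_0 y). lra. }
  set (rho := sqrt (x ^ 2 + y ^ 2)).
  assert (Hrho : 0 < rho) by now apply sqrt_lt_R0.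
  assert (Hsq : rho ^ 2 = x ^ 2 + y ^ 2) by (apply pow2_sqrt; lra).
  assert (Hc : -1 <= y / rho <= 1).
  { pose proof (pow2_ge_0 x).
    split; [apply Rle_div_r | apply Rle_div_l]; try exact Hrho; nra. }
  assert (Hs : sin (acos (y / rho)) = Rabs x / rho).
  { rewrite sin_acos by exact Hc.
    replace (1 - (y / rho)²) with ((x / rho)²).
    - rewrite sqrt_Rsqr_abs. unfold Rdiv. rewrite Rabs_mult, Rabs_inv, (Rabs_pos_eq rho); lra.
    - unfold Rsqr. assert (x * x = rho * rho - y * y) by lra.
      apply (Rmult_eq_reg_r (rho * rho)); [| nra]. field_simplify; lra. }
  exists (ln rho). rewrite exp_ln by exact Hrho.
  destruct (Rle_dec 0 x) as [Hx | Hx].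
  - exists (acos (y / rho)). rewrite Hs, cos_acos, Rabs_pos_eq by assumption.
    split; field; lra.
  - exists (- acos (y / rho)).
    rewrite sin_neg, cos_neg, Hs, cos_acos, Rabs_left1 by (assumption || lra).
    split; field; lra.
Qed.

(** * Closed orbits around a restoring force *)

(** On the right half-line mu >= 1, because h <= 0, so V' = - g mu is at least alpha
    beyond 1. *)
Lemma energy_growth (g h mu V : R -> R) (alpha : R) :
  (forall x, 0 < mu x) -> mu 0 = 1 -> V 0 = 0 ->
  (forall x, is_derive mu x (- 2 * h x * mu x)) ->
  (forall x, is_derive V x (- g x * mu x)) ->
  0 <= alpha ->
  (forall x, 0 < x -> g x < 0 /\ h x <= 0) ->
  (forall x, 1 <= x -> g x <= - alpha) ->
  (forall x, 0 < x -> 0 < V x) /\ (forall x, 1 <= x -> alpha * (x - 1) <= V x).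
Proof.
  intros Hpos Hmu0 HV0 Hmu HV Hal Hgh Hg1.
  assert (HVpos : forall x, 0 < x -> 0 < V x).
  { intros x Hx. rewrite <- HV0.
    apply (increasing_of_derive V (fun z => - g z * mu z)); [exact Hx | auto |].
    intros s Hs. destruct (Hgh s ltac:(lra)). apply Rmult_lt_0_compat; [lra | apply Hpos]. }
  split; [exact HVpos |].
  assert (Hmu1 : forall x, 0 <= x -> 1 <= mu x).
  { intros x Hx. rewrite <- Hmu0.
    apply (nondecreasing_of_derive mu (fun z => - 2 * h z * mu z)); [exact Hx | auto |].
    intros s Hs. destruct (Hgh s ltac:(lra)). specialize (Hpos s).
    apply Rmult_le_pos; lra. }
  intros x Hx.
  assert (H : V 1 - alpha * 1 <= V x - alpha * x).
  { apply (nondecreasing_of_derive (fun z => V z - alpha * z) (fun z => - g z * mu z - alpha));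
      [exact Hx | |].
    - intros s _. auto_derive; [eexists; apply HV |].
      rewrite (is_derive_unique (fun u : R => V u) _ _ (HV s)). ring.
    - intros s Hs. assert (H1 := Hg1 s ltac:(lra)). assert (H2 := Hmu1 s ltac:(lra)). nra. }
  specialize (HVpos 1 ltac:(lra)). lra.
Qed.

(** The left half-line reduces to the right one by the reflection of the x-axis, which
    replaces g and h by - g(-x) and - h(-x). *)
Lemma energy_grows_both_sides (g h mu V : R -> R) (alpha : R) :
  (forall x, 0 < mu x) -> mu 0 = 1 -> V 0 = 0 ->
  (forall x, is_derive mu x (- 2 * h x * mu x)) ->
  (forall x, is_derive V x (- g x * mu x)) ->
  0 <= alpha ->
  (forall x, 0 < x -> g x < 0 /\ h x <= 0) -> (forall x, x < 0 -> 0 < g x /\ 0 <= h x) ->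
  (forall x, 1 <= x -> g x <= - alpha) -> (forall x, x <= -1 -> alpha <= g x) ->
  (forall x, x <> 0 -> 0 < V x) /\
  (forall x, 1 <= Rabs x -> alpha * (Rabs x - 1) <= V x).
Proof.
  intros Hpos Hmu0 HV0 Hmu HV Hal Hright Hleft Hg1 Hg2.
  destruct (energy_growth g h mu V alpha) as [HR1 HR2]; auto.
  destruct (energy_growth (fun x => - g (- x)) (fun x => - h (- x))
              (fun x => mu (- x)) (fun x => V (- x)) alpha) as [HL1 HL2].
  - auto.
  - now rewrite Ropp_0.
  - now rewrite Ropp_0.
  - intros x. auto_derive; [eexists; apply Hmu |].
    rewrite (is_derive_unique (fun u : R => mu u) _ _ (Hmu (- x))). ring.
  - intros x. auto_derive; [eexists; apply HV |].
    rewrite (is_derive_unique (fun u : R => V u) _ _ (HV (- x))). ring.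
  - exact Hal.
  - intros x Hx. destruct (Hleft (- x)); lra.
  - intros x Hx. specialize (Hg2 (- x)). lra.
  - split; intros x Hx.
    + destruct (Rdichotomy x 0 Hx); [| now apply HR1].
      rewrite <- (Ropp_involutive x). apply HL1. lra.
    + destruct (Rle_dec 0 x).
      * rewrite Rabs_pos_eq in * by lra. now apply HR2.
      * rewrite Rabs_left in * by lra. assert (H := HL2 (- x) Hx).
        simpl in H. now rewrite Ropp_involutive in H.
Qed.

(** Let K = y^2 - x F(x,y), which is positive off the origin. In coordinates
    x = exp v sin th, y = exp v cos th, the first integral E has v-derivative mu K > 0, and
    the angle moves along a solution with speed K / (x^2 + y^2) > 0. The level set of E
    through the given point is then a closed graph v = r(th), whose tangent is the vector
    field multiplied by k = (x^2 + y^2) / K. *)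
Lemma restoring_force_recurrent (g h : R -> R) (alpha : R) :
  (forall x, continuous g x) -> (forall x, continuous h x) -> 0 < alpha ->
  (forall x, 0 < x -> g x < 0 /\ h x <= 0) -> (forall x, x < 0 -> 0 < g x /\ 0 <= h x) ->
  (forall x, 1 <= x -> g x <= - alpha) -> (forall x, x <= -1 -> alpha <= g x) ->
  forall x0 y0, (x0, y0) <> (0, 0) -> exists x y T,
    motion (fun x y => g x + h x * y ^ 2) x y /\ x 0 = x0 /\ y 0 = y0 /\ 0 < T /\
    forall t, x (t + T) = x t /\ y (t + T) = y t.
Proof.
  intros Hg Hh Hal Hright Hleft Hg1 Hg2 x0 y0 Hne.
  destruct (energy_coefficients g h Hg Hh) as [mu [V [Hpos [Hmu0 [HV0 [Hmu HV]]]]]].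
  destruct (energy_grows_both_sides g h mu V alpha) as [HVpos HVinf]; auto; [lra |].
  set (F := fun x y => g x + h x * y ^ 2).
  set (K := fun x y => y ^ 2 - x * F x y).
  set (E := fun x y => y ^ 2 * mu x / 2 + V x).
  assert (HK : forall x y, (x, y) <> (0, 0) -> 0 < K x y).
  { intros x y Hxy. unfold K, F. assert (Hy2 := pow2_ge_0 y).
    assert (Hxg : x <> 0 -> 0 < - x * g x /\ 0 <= - x * h x).
    { intros Hx. destruct (Rdichotomy x 0 Hx) as [Hx' | Hx'];
        [destruct (Hleft x Hx') | destruct (Hright x Hx')]; split; nra. }
    destruct (Req_dec x 0) as [-> | Hx].
    - assert (y <> 0) by (intros ->; now apply Hxy).
      assert (0 < y ^ 2) by now apply pow2_gt_0. lra.
    - destruct (Hxg Hx) as [Hxg' Hxh]. assert (H := Rmult_le_pos _ _ Hxh Hy2). lra. }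
  assert (HE : forall x y, (x, y) <> (0, 0) -> 0 < E x y).
  { intros x y Hxy. unfold E. assert (Hy2 := pow2_ge_0 y). assert (Hm := Hpos x).
    destruct (Req_dec x 0) as [-> | Hx].
    - assert (y <> 0) by (intros ->; now apply Hxy).
      assert (0 < y ^ 2) by now apply pow2_gt_0. rewrite HV0. nra.
    - assert (0 < V x) by auto. nra. }
  set (px := fun th v => exp v * sin th). set (py := fun th v => exp v * cos th).
  assert (Hp0 : forall th v, (px th v, py th v) <> (0, 0)).
  { intros th v H. injection H as H1 H2. unfold px, py in H1, H2.
    assert (Hev := exp_pos v). assert (Hsc := sin2_cos2 th). unfold Rsqr in Hsc.
    assert (sin th = 0) by nra. assert (cos th = 0) by nra. nra. }
  set (Ev := fun th v => mu (px th v) * K (px th v) (py th v)).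
  set (Eth := fun th v =>
    - mu (px th v) * py th v * (px th v + F (px th v) (py th v))).
  assert (HEv : forall th v, is_derive (fun v => E (px th v) (py th v)) v (Ev th v)).
  { intros th v. unfold E, Ev, K, F, px, py.
    auto_derive; [repeat split; eexists; eauto |].
    rewrite (is_derive_unique (fun u : R => mu u) _ _ (Hmu _)),
      (is_derive_unique (fun u : R => V u) _ _ (HV _)). field. }
  assert (HEth : forall th v, is_derive (fun th => E (px th v) (py th v)) th (Eth th v)).
  { intros th v. unfold E, Eth, F, px, py.
    auto_derive; [repeat split; eexists; eauto |].
    rewrite (is_derive_unique (fun u : R => mu u) _ _ (Hmu _)),
      (is_derive_unique (fun u : R => V u) _ _ (HV _)). field. }
  assert (HEvpos : forall th v, 0 < Ev th v).
  { intros th v. apply Rmult_lt_0_compat; [apply Hpos | apply HK, Hp0]. }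
  assert (Hpx2 : forall th v, continuity_2d_pt px th v).
  { intros th v. apply continuity_2d_pt_mult.
    - apply (continuity_1d_2d_pt_comp exp (fun _ v => v));
        [apply derivable_continuous, derivable_exp | apply continuity_2d_pt_id2].
    - apply (continuity_1d_2d_pt_comp sin (fun th _ => th));
        [apply continuity_sin | apply continuity_2d_pt_id1]. }
  assert (Hpy2 : forall th v, continuity_2d_pt py th v).
  { intros th v. apply continuity_2d_pt_mult.
    - apply (continuity_1d_2d_pt_comp exp (fun _ v => v));
        [apply derivable_continuous, derivable_exp | apply continuity_2d_pt_id2].
    - apply (continuity_1d_2d_pt_comp cos (fun th _ => th));
        [apply continuity_cos | apply continuity_2d_pt_id1]. }
  assert (Hcomp : forall u : R -> R, (forall x, continuous u x) ->
            forall th v, continuity_2d_pt (fun th v => u (px th v)) th v).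
  { intros u Hu th v. apply (continuity_1d_2d_pt_comp u px); [| apply Hpx2].
    apply continuity_pt_filterlim, Hu. }
  assert (Hmuc : forall x, continuous mu x).
  { intros x. apply (ex_derive_continuous (V := R_NormedModule)). eexists. apply Hmu. }
  assert (Hsq : forall th v, continuity_2d_pt (fun th v => py th v ^ 2) th v).
  { intros th v. apply (continuity_2d_pt_ext (fun th v => py th v * py th v)).
    - intros. ring.
    - apply continuity_2d_pt_mult; apply Hpy2. }
  assert (HKc : forall th v, continuity_2d_pt (fun th v => K (px th v) (py th v)) th v).
  { intros th v. unfold K, F. apply continuity_2d_pt_minus; [apply Hsq |].
    apply continuity_2d_pt_mult; [apply Hpx2 |].
    apply continuity_2d_pt_plus; [now apply Hcomp |].
    apply continuity_2d_pt_mult; [now apply Hcomp | apply Hsq]. }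
  assert (HEvc : forall th v, continuity_2d_pt Ev th v).
  { intros th v. apply continuity_2d_pt_mult; [now apply Hcomp | apply HKc]. }
  set (e := E x0 y0).
  assert (He : 0 < e) by now apply HE.
  assert (Hray : forall th, exists v, E (px th v) (py th v) = e).
  { intros th.
    set (f := fun s => E (s * sin th) (s * cos th)).
    assert (Hfc : continuity f).
    { intros s. apply continuity_pt_filterlim, (ex_derive_continuous (V := R_NormedModule)).
      unfold f, E. auto_derive. repeat split; eexists; eauto. }
    (* On the y-axis V vanishes and the kinetic term is used; on the other rays the potential
       alone reaches e once |x| = 1 + e / alpha. *)
    assert (Hlarge : exists s, 0 < s /\ e <= f s).
    { unfold f, E. destruct (Req_dec (sin th) 0) as [Hs | Hs].
      - exists (2 * e + 1). split; [lra |].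
        assert (Hc := sin2_cos2 th). rewrite Hs, Rsqr_0, Rplus_0_l in Hc. unfold Rsqr in Hc.
        rewrite Hs, Rmult_0_r, Hmu0, HV0.
        replace (((2 * e + 1) * cos th) ^ 2) with ((2 * e + 1) ^ 2 * (cos th * cos th)) by ring.
        rewrite Hc. nra.
      - assert (HR : 0 < Rabs (sin th)) by now apply Rabs_pos_lt.
        assert (Hea : 0 < e / alpha) by now apply Rdiv_lt_0_compat.
        exists ((1 + e / alpha) / Rabs (sin th)).
        assert (Hs0 : 0 < (1 + e / alpha) / Rabs (sin th)) by (apply Rdiv_lt_0_compat; lra).
        split; [exact Hs0 |].
        set (s := (1 + e / alpha) / Rabs (sin th)) in *.
        assert (Habs : Rabs (s * sin th) = 1 + e / alpha).
        { rewrite Rabs_mult, (Rabs_pos_eq s) by lra. unfold s. field. lra. }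
        assert (HV1 := HVinf (s * sin th)). rewrite Habs in HV1.
        assert (alpha * (1 + e / alpha - 1) = e) by (field; lra).
        assert (Hm := Hpos (s * sin th)). assert (Hy2 := pow2_ge_0 (s * cos th)).
        specialize (HV1 ltac:(lra)). nra. }
    destruct Hlarge as [S [HS HSe]].
    assert (Hf0 : f 0 = 0).
    { unfold f, E. rewrite !Rmult_0_l, HV0. field. }
    destruct (IVT_gen f 0 S e Hfc) as [s [Hs Hfs]].
    { rewrite Hf0.
      split; [eapply Rle_trans; [apply Rmin_l |] | eapply Rle_trans; [| apply Rmax_r]]; lra. }
    rewrite Rmin_left, Rmax_right in Hs by lra.
    assert (s <> 0) by (intros ->; lra).
    exists (ln s). unfold px, py. rewrite exp_ln by lra. exact Hfs. }
  destruct (functional_choice _ Hray) as [r Hr].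
  assert (Hinc : forall th v1 v2, v1 < v2 <-> E (px th v1) (py th v1) < E (px th v2) (py th v2)).
  { intros th. now apply (strictly_increasing_of_derive _ (Ev th)). }
  assert (Hinj : forall th v1 v2, E (px th v1) (py th v1) = E (px th v2) (py th v2) -> v1 = v2).
  { intros th v1 v2 Heq. destruct (Rtotal_order v1 v2) as [H | [H | H]];
      [| exact H |]; apply (proj1 (Hinc th _ _)) in H; lra. }
  assert (Hdr := implicit_derive (fun th v => E (px th v) (py th v)) Eth Ev r e
                   HEth HEv HEvc HEvpos Hr).
  set (P := 2 * PI).
  assert (HP : 0 < P) by (unfold P; assert (HPI := PI_RGT_0); lra).
  assert (Hsin : forall th, sin (th + P) = sin th).
  { intros th. unfold P. rewrite sin_plus, sin_2PI, cos_2PI. ring. }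
  assert (Hcos : forall th, cos (th + P) = cos th).
  { intros th. unfold P. rewrite cos_plus, sin_2PI, cos_2PI. ring. }
  assert (HrP : forall th, r (th + P) = r th).
  { intros th. apply (Hinj th). rewrite Hr. unfold px, py.
    rewrite <- Hsin, <- Hcos at 1. exact (Hr (th + P)). }
  set (X := fun th => px th (r th)). set (Y := fun th => py th (r th)).
  set (k := fun th => (X th ^ 2 + Y th ^ 2) / K (X th) (Y th)).
  assert (HXP : forall th, X (th + P) = X th).
  { intros th. unfold X, px. now rewrite Hsin, HrP. }
  assert (HYP : forall th, Y (th + P) = Y th).
  { intros th. unfold Y, py. now rewrite Hcos, HrP. }
  assert (HKX : forall th, 0 < K (X th) (Y th)) by (intros th; apply HK, Hp0).
  assert (Hr' : forall th, is_derive r th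
                  (Y th * (X th + F (X th) (Y th)) / K (X th) (Y th))).
  { intros th. evar_last; [apply Hdr |]. unfold Eth, Ev.
    change (px th (r th)) with (X th). change (py th (r th)) with (Y th).
    assert (Hk := HKX th). assert (Hm := Hpos (X th)). field. lra. }
  assert (Hturn : forall th l, is_derive r th l ->
            is_derive X th (l * X th + Y th) /\ is_derive Y th (l * Y th - X th)).
  { intros th l Hl. unfold X, Y, px, py.
    split; (auto_derive; [now exists l |]);
      rewrite (is_derive_unique (fun u : R => r u) _ _ Hl); ring. }
  assert (HX : forall th, is_derive X th (k th * Y th)).
  { intros th. assert (Hk := HKX th).
    evar_last; [exact (proj1 (Hturn th _ (Hr' th))) |]. unfold k.
    apply (Rmult_eq_reg_r (K (X th) (Y th))); [| lra].
    field_simplify; [unfold K; ring | lra | lra]. }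
  assert (HY : forall th, is_derive Y th (k th * F (X th) (Y th))).
  { intros th. assert (Hk := HKX th).
    evar_last; [exact (proj2 (Hturn th _ (Hr' th))) |]. unfold k.
    apply (Rmult_eq_reg_r (K (X th) (Y th))); [| lra].
    field_simplify; [unfold K; ring | lra | lra]. }
  assert (Hrho : forall th v, px th v ^ 2 + py th v ^ 2 = exp v ^ 2).
  { intros th v. unfold px, py. assert (Hsc := sin2_cos2 th). unfold Rsqr in Hsc.
    replace ((exp v * sin th) ^ 2 + (exp v * cos th) ^ 2)
      with (exp v ^ 2 * (sin th * sin th + cos th * cos th)) by ring.
    rewrite Hsc. ring. }
  assert (Hkc : forall th, continuous k th).
  { intros th. unfold k, X, Y.
    apply (continuous_comp_2 (fun th : R => th) r
      (fun th v => (px th v ^ 2 + py th v ^ 2) / K (px th v) (py th v))).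
    - apply continuous_id.
    - apply (ex_derive_continuous (V := R_NormedModule)). eexists. apply Hr'.
    - apply (proj1 (continuity_2d_pt_filterlim
        (fun th v => (px th v ^ 2 + py th v ^ 2) / K (px th v) (py th v)) th (r th))).
      apply continuity_2d_pt_mult.
      + apply (continuity_2d_pt_ext (fun _ v => exp v ^ 2)); [intros; now rewrite Hrho |].
        apply (continuity_1d_2d_pt_comp (fun v => exp v ^ 2) (fun _ v => v));
          [| apply continuity_2d_pt_id2].
        apply continuity_pt_filterlim, (ex_derive_continuous (V := R_NormedModule)).
        now auto_derive.
      + apply continuity_2d_pt_inv; [apply HKc |].
        assert (H := HK _ _ (Hp0 th (r th))). lra. }
  assert (Hkpos : forall th, 0 < k th).
  { intros th. apply Rdiv_lt_0_compat; [| apply HKX].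
    unfold X, Y. rewrite Hrho. apply pow_lt, exp_pos. }
  destruct (polar_coordinates x0 y0 Hne) as [v0 [th0 [Hx0 Hy0]]].
  assert (Hr0 : r th0 = v0).
  { apply (Hinj th0). rewrite Hr. unfold e. rewrite Hx0, Hy0. reflexivity. }
  destruct (motion_along_closed_curve F X Y k P) with (s0 := th0)
    as [x [y [T [Hmot [Hx [Hy [HT Hper]]]]]]]; auto.
  { intros th. unfold k. now rewrite HXP, HYP. }
  exists x, y, T. split; [exact Hmot |].
  split; [rewrite Hx, Hx0; unfold X; now rewrite Hr0 |].
  split; [rewrite Hy, Hy0; unfold Y; now rewrite Hr0 |]. auto.
Qed.

Lemma restoring_force_global_center (g h : R -> R) (alpha : R) :
  (forall x, continuous g x) -> (forall x, continuous h x) -> 0 < alpha ->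
  (forall x, 0 < x -> g x < 0 /\ h x <= 0) -> (forall x, x < 0 -> 0 < g x /\ 0 <= h x) ->
  (forall x, 1 <= x -> g x <= - alpha) -> (forall x, x <= -1 -> alpha <= g x) ->
  forall X : R * R -> R * R,
  (forall x y, X (x, y) = (y, g x + h x * y ^ 2)) -> X (0, 0) = (0, 0) ->
  is_global_center X (0, 0).
Proof.
  intros Hg Hh Hal Hright Hleft Hg1 Hg2 X HX HX0.
  assert (Hall : forall q, q <> (0, 0) -> on_nontrivial_periodic_orbit X q).
  { intros [x0 y0] Hne.
    destruct (restoring_force_recurrent g h alpha Hg Hh Hal Hright Hleft Hg1 Hg2 x0 y0 Hne)
      as [x [y [T [Hmot [Hx [Hy [HT Hper]]]]]]].
    exists (fun t => (x t, y t)), T.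
    split; [| split; [| split; [exact HT | split]]].
    - intros t. rewrite HX. exact (Hmot t).
    - now rewrite Hx, Hy.
    - intros t. destruct (Hper t) as [-> ->]. reflexivity.
    - apply NNPP. intros Hconst.
      assert (Hfix : forall t, x t = x 0 /\ y t = y 0).
      { intros t. apply NNPP. intros Ht. apply Hconst. exists t. intros Heq. apply Ht.
        injection Heq. auto. }
      destruct (Hmot 0) as [Hdx Hdy].
      assert (Hy0 : y 0 = 0).
      { rewrite <- (is_derive_unique _ _ _ Hdx).
        rewrite (Derive_ext _ (fun _ => x 0)); [apply Derive_const | apply Hfix]. }
      assert (Hf0 : g (x 0) + h (x 0) * y 0 ^ 2 = 0).
      { rewrite <- (is_derive_unique _ _ _ Hdy).
        rewrite (Derive_ext _ (fun _ => y 0)); [apply Derive_const | apply Hfix]. }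
      rewrite Hy0 in Hf0. assert (Hx0 : x 0 <> 0).
      { intros Hx0. apply Hne. now rewrite <- Hx, <- Hy, Hx0, Hy0. }
      destruct (Rdichotomy _ _ Hx0) as [Hs | Hs];
        [destruct (Hleft _ Hs) | destruct (Hright _ Hs)]; lra. }
  split; [split; [exact HX0 |] | exact Hall].
  apply filter_forall. exact Hall.
Qed.

(** * The characterization *)

Lemma odd_power_opp (j : nat) (x : R) : (- x) ^ (2 * j + 1) = - x ^ (2 * j + 1).
Proof.
  replace (- x) with (-1 * x) by ring.
  rewrite Rpow_mult_distr, Nat.add_1_r, pow_1_odd. ring.
Qed.

Lemma global_center_sufficient (j : nat) (delta a b : R) :
  delta <= 0 -> a <= 0 -> b <= 0 -> delta ^ 2 + a ^ 2 <> 0 ->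
  has_global_center (kukles_even (2 * j + 3) delta a b).
Proof.
  intros Hd Ha Hb Hne. exists (0, 0).
  set (g := fun x => delta * x + a * x ^ (2 * j + 3)).
  set (h := fun x => b * x ^ (2 * j + 1)).
  assert (Hn : forall x, (- x) ^ (2 * j + 3) = - x ^ (2 * j + 3)).
  { intros x. replace (2 * j + 3)%nat with (2 * S j + 1)%nat by lia. apply odd_power_opp. }
  assert (Hg : forall x, g (- x) = - g x) by (intros x; unfold g; rewrite Hn; ring).
  assert (Hh : forall x, h (- x) = - h x) by (intros x; unfold h; rewrite odd_power_opp; ring).
  assert (Hsum : 0 < - delta - a).
  { apply Rnot_le_lt. intros Hle. apply Hne.
    replace delta with 0 by lra. replace a with 0 by lra. ring. }
  assert (Hright : forall x, 0 < x -> g x < 0 /\ h x <= 0).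
  { intros x Hx. unfold g, h.
    assert (H1 := pow_lt x (2 * j + 3) Hx). assert (H2 := pow_lt x (2 * j + 1) Hx).
    split; [| nra]. destruct (Req_dec delta 0) as [-> | Hd0]; nra. }
  assert (Hg1 : forall x, 1 <= x -> g x <= - (- delta - a)).
  { intros x Hx. unfold g. assert (1 <= x ^ (2 * j + 3)) by now apply pow_R1_Rle. nra. }
  apply (restoring_force_global_center g h (- delta - a)).
  - intros x. apply (ex_derive_continuous (V := R_NormedModule)). unfold g. now auto_derive.
  - intros x. apply (ex_derive_continuous (V := R_NormedModule)). unfold h. now auto_derive.
  - exact Hsum.
  - exact Hright.
  - intros x Hx. destruct (Hright (- x)) as [H1 H2]; [lra |].
    rewrite Hg in H1. rewrite Hh in H2. lra.
  - exact Hg1.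
  - intros x Hx. specialize (Hg1 (- x)). rewrite Hg in Hg1. lra.
  - intros x y. unfold kukles_even, g, h.
    now replace (2 * j + 3 - 2)%nat with (2 * j + 1)%nat by lia.
  - unfold kukles_even. f_equal. rewrite !pow_i by lia. ring.
Qed.

Lemma has_global_center_ext (X1 X2 : R * R -> R * R) :
  (forall p, X1 p = X2 p) -> has_global_center X2 -> has_global_center X1.
Proof.
  intros Heq. now replace X1 with X2 by (symmetry; now apply functional_extensionality).
Qed.

Theorem theorem5p1 (n : nat) (delta : R) (a : nat -> nat -> R)
  (hn : (2 <= n)%nat) (hdelta : delta <= 0)
  (ha : exists i : nat, (i <= n)%nat /\ a (n - i)%nat i <> 0) :
  has_global_center (kukles n delta a) <->
  ((forall p : R * R,
      kukles n delta a p = kukles_even n delta (a n 0%nat) (a (n - 2)%nat 2%nat) p) /\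
   delta <= 0 /\ Nat.Odd n /\ a n 0%nat <= 0 /\ a (n - 2)%nat 2%nat <= 0 /\
   delta ^ 2 + (a n 0%nat) ^ 2 <> 0).
Proof.
  split.
  - intros Hgc.
    destruct (global_center_necessary n delta a hn hdelta ha Hgc) as [H1 H2]. auto.
  - intros [Heven [_ [[k Hk] [Ha0 [Ha2 Hne]]]]].
    apply (has_global_center_ext _ _ Heven).
    assert (Hj : exists j, n = (2 * j + 3)%nat) by (exists (k - 1)%nat; lia).
    destruct Hj as [j Hj]. clear k Hk. subst n.
    now apply global_center_sufficient.
Qed.
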